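(* Let $A$ be an octonion division algebra over a field $F$, let $f(x)\in A[x]$, and let $\lambda\in A$ be a root of $f(x)$. Write $T=\mathrm{Tr}(\lambda)$, $N=\mathrm{Norm}(\lambda)$, $E=E(N,T)$ and $G=G(N,T)$ (as defined in the context), and let $[\lambda]$ be the conjugacy class of $\lambda$. (1) If $E=0$, then $[\lambda]\subseteq LMR(f(x))$. (2) If $E\neq 0$ and $E$ and $G$ lie in a quaternion subalgebra $Q$ of $A$, then $A$ decomposes as a Cayley doubling $A=Q\oplus Q\ell$ with $\ell^2=\gamma\in F^\times$, and $$LMR(f(x))\cap[\lambda]=\left\{\frac{-1}{\mathrm{Norm}(a+b\ell)}\Big(\mathrm{Norm}(a)E^{-1}G-\gamma\,\mathrm{Norm}(b)\,GE^{-1}+\big(b[\overline G,E^{-1}]\overline a\big)\ell\Big) : a,b\in Q,\ (a,b)\neq(0,0)\right\}.$$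
   Context: Octonion algebras: let $Q$ be a quaternion algebra over a field $F$ (any characteristic) with canonical involution $z\mapsto\overline z$, and let $\gamma\in F^\times$. The octonion algebra $A=Q\oplus Q\ell$ (the Cayley doubling of $Q$ with $\ell^2=\gamma$) has multiplication $(q+r\ell)(s+t\ell)=qs+\gamma\overline{t}r+(tq+r\overline{s})\ell$ for $q,r,s,t\in Q$, involution $\overline{q+r\ell}=\overline q-r\ell$, trace $\mathrm{Tr}(z)=z+\overline z\in F$ and norm $\mathrm{Norm}(z)=z\overline z\in F$. It is a division algebra iff every nonzero element is invertible, equivalently iff the norm form is anisotropic. $A^\times$ denotes the set of invertible elements. Every $\lambda\in A$ satisfies $\lambda^2-\mathrm{Tr}(\lambda)\lambda+\mathrm{Norm}(\lambda)=0$. Notation: $[x,y]=xy-yx$. The conjugacy class of $\lambda$ is $[\lambda]=\{q\lambda q^{-1}:q\in A^\times\}$; in an octonion division algebra two elements are conjugate iff they have the same trace and norm. Polynomials: $A[x]=A\otimes_F F[x]$, so $x$ is central. For $f(x)=a_nx^n+\dots+a_1x+a_0\in A[x]$ and $\lambda\in A$, $f(\lambda)=a_n\lambda^n+\dots+a_1\lambda+a_0$; $\lambda$ is a root of $f$ if $f(\lambda)=0$, and $R(f(x))$ is the set of roots of $f$ in $A$. For $c\in A^\times$, $cf(x)=(ca_n)x^n+\dots+(ca_1)x+ca_0$, and $LMR(f(x))=\bigcup_{c\in A^\times}R(cf(x))$. Definition of $E(N,T)$ and $G(N,T)$: using the rule $\lambda^2=T\lambda-N$, the expression $f(\lambda)$,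 for $\lambda$ of trace $T$ and norm $N$, reduces to the linear expression $E(N,T)\lambda+G(N,T)$. Explicitly, define $p_k,q_k\in F$ by $p_0=0$, $q_0=1$, $p_{k+1}=Tp_k+q_k$, $q_{k+1}=-Np_k$ (so that $\lambda^k=p_k\lambda+q_k$); then $E(N,T)=\sum_{k=0}^n p_ka_k$ and $G(N,T)=\sum_{k=0}^n q_ka_k$. *)

(* Defs.v *)
From HB Require Import structures.
From mathcomp Require Import all_boot all_algebra all_field.
From mathcomp Require Import classical_sets.

Set Implicit Arguments.
Unset Strict Implicit.
Unset Printing Implicit Defensive.

Import GRing.Theory.
Local Open Scope ring_scope.

(* Quaternion algebra over F, uniformly in all characteristics: a central     *)
(* simple F-algebra of dimension 4.                                           *)
Definition quaternion_algebra (F : fieldType) (B : falgType F) : Prop :=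
  [/\ \dim {:B} = 4%N,
      ('Z({:B}) = 1)%VS
    & forall I : {vspace B}, ({:B} * I <= I)%VS -> (I * {:B} <= I)%VS ->
        I = 0%VS \/ I = fullv].

(* On a quaternion algebra this pins s down uniquely (also in characteristic  *)
(* 2), since every element is a root of 'X^2 - (x + s x) 'X + x * s x.        *)
(* Here 1%VS is the line F.1.                                                 *)
Definition canonical_involution (F : fieldType) (B : falgType F)
    (s : {linear B -> B}) : Prop :=
  [/\ involutive s,
      forall x y, s (x * y) = s y * s x,
      forall x, x + s x \in 1%VS
    & forall x, x * s x \in 1%VS].

Record quaternionAlgebra (F : fieldType) := QuaternionAlgebra {
  quat_sort :> falgType F;
  quat_conj : {linear quat_sort -> quat_sort};
  quat_algP : quaternion_algebra quat_sort;
  quat_conjP : canonical_involution quat_conj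
}.

Arguments quat_conj {F} {_}.

Record octonionAlgebra (F : fieldType) := OctonionAlgebra {
  oct_base : quaternionAlgebra F;
  oct_gamma : F;
  oct_gamma_neq0 : oct_gamma != 0
}.

(* The pair (q, r) stands for q + r l. Beware that * on oct A would unfold to *)
(* the componentwise product; the octonion product is omul, written *o.       *)
Definition oct (F : fieldType) (A : octonionAlgebra F) : Type :=
  (oct_base A * oct_base A)%type.
Coercion oct : octonionAlgebra >-> Sortclass.
HB.instance Definition _ (F : fieldType) (A : octonionAlgebra F) :=
  Vector.copy (oct A) (oct_base A * oct_base A)%type.

Section Octonion.
Variables (F : fieldType) (A : octonionAlgebra F).
Implicit Types (z w lam mu : A) (N T : F) (n : nat) (U : {vspace A}).

Definition oone : A := (1, 0).

Definition omul z w : A :=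
  let: (q, r) := z in let: (s, t) := w in
  (q * s + oct_gamma A *: (quat_conj t * r), t * q + r * quat_conj s).

Definition oconj z : A := (quat_conj z.1, - z.2).

Local Notation "x *o y" := (omul x y) (at level 40, left associativity).

Definition ocomm z w : A := z *o w - w *o z.

(* The coordinate along 1 of an element of the line F.1. *)
Definition oscal z : F := coord [tuple oone] ord0 z.

Definition otr z : F := oscal (z + oconj z).
Definition onorm z : F := oscal (z *o oconj z).

Definition ounit : set A :=
  [set z | exists w, z *o w = oone /\ w *o z = oone]%classic.

(* z is invertible iff its norm is nonzero, and this is then its inverse.     *)
Definition oinv z : A := (onorm z)^-1 *: oconj z.

Definition odivision : Prop := forall z, z != 0 -> ounit z.

Definition conjclass lam : set A :=
  [set (q *o lam) *o oinv q | q in ounit]%classic.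

Fixpoint opow z n : A := if n is m.+1 then z *o opow z m else oone.

(* The polynomial a_n x^n + ... + a_0 is given by n and its coefficient       *)
(* function a : 'I_n.+1 -> A; a_n = 0 is allowed.                             *)
Definition oeval n (a : 'I_n.+1 -> A) lam : A :=
  \sum_(k < n.+1) a k *o opow lam k.

Definition oroots n (a : 'I_n.+1 -> A) : set A :=
  [set lam | oeval a lam = 0]%classic.

Definition oscale n (c : A) (a : 'I_n.+1 -> A) : 'I_n.+1 -> A :=
  fun k => c *o a k.

Definition LMR n (a : 'I_n.+1 -> A) : set A :=
  (\bigcup_(c in ounit) oroots (oscale c a))%classic.

(* The pair (p_k, q_k), for which z^k = p_k z + q_k if z^2 = T z - N. *)
Fixpoint pq N T n : F * F :=
  if n is m.+1 then
    let: (p, q) := pq N T m in (T * p + q, - (N * p))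
  else (0, 1).

Definition Epol n (a : 'I_n.+1 -> A) N T : A :=
  \sum_(k < n.+1) (pq N T k).1 *: a k.
Definition Gpol n (a : 'I_n.+1 -> A) N T : A :=
  \sum_(k < n.+1) (pq N T k).2 *: a k.

Definition quaternion_subalgebra U : Prop :=
  exists (B : falgType F) (i : 'Hom(B, A)),
    [/\ quaternion_algebra B, lker i = 0%VS, i 1 = oone,
        forall x y, i (x * y) = i x *o i y
      & limg i = U].

(* A = U (+) U l is the Cayley doubling of U with l^2 = g. The canonical      *)
(* involution of a quaternion subalgebra U is the restriction of oconj.       *)
Definition cayley_doubling U (l : A) (g : F) : Prop :=
  [/\ g != 0,
      l *o l = g *: oone,
      forall z, exists! p : A * A,
        [/\ p.1 \in U, p.2 \in U & z = p.1 + p.2 *o l],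
      {in U & U, forall q r, {in U & U, forall s t,
        (q + r *o l) *o (s + t *o l) =
        (q *o s + g *: (oconj t *o r)) + (t *o q + r *o oconj s) *o l}}
    & {in U & U, forall q r,
        oconj (q + r *o l) = oconj q - r *o l}].

Lemma oscalE z : z \in <[oone]>%VS -> oscal z *: oone = z.
Proof.
by rewrite -span_seq1 => /(@coord_span _ _ _ [tuple oone]); rewrite big_ord1 => {2}->.
Qed.

Lemma oone_line (x : oct_base A) : x \in 1%VS -> ((x, 0) : A) \in <[oone]>%VS.
Proof.
by case/vlineP=> k ->; apply/vlineP; exists k; congr pair; rewrite scaler0.
Qed.

Lemma otrE z : otr z *: oone = z + oconj z.
Proof.
apply: oscalE; case: z => q r.
have [_ _ Hq _] := quat_conjP (oct_base A).
suff -> : ((q, r) : A) + oconj (q, r) = (q + quat_conj q, 0) by apply/oone_line.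
by congr pair; rewrite /= subrr.
Qed.

Lemma onorm_subproof z : z *o oconj z \in <[oone]>%VS.
Proof.
case: z => q r; have [Hi _ _ Hq] := quat_conjP (oct_base A).
suff -> : ((q, r) : A) *o oconj (q, r) =
    (q * quat_conj q - oct_gamma A *: (quat_conj r * r), 0).
  apply/oone_line/rpredB; first exact: Hq.
  by apply: rpredZ; rewrite -{2}[r]Hi; apply: Hq.
by rewrite /omul /= Hi raddfN mulNr scalerN mulNr addNr.
Qed.

Lemma onormE z : onorm z *: oone = z *o oconj z.
Proof. exact/oscalE/onorm_subproof. Qed.

Lemma quat_conjC (q : oct_base A) : quat_conj q * q = q * quat_conj q.
Proof.
have [_ _ /(_ q)/vlineP[k Hk] _] := quat_conjP (oct_base A).
have -> : quat_conj q = k%:A - q by rewrite -Hk addrC addKr.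
by rewrite mulrBl mulrBr -scalerAl -scalerAr mul1r mulr1.
Qed.

Lemma onormC z : oconj z *o z = onorm z *: oone.
Proof.
rewrite onormE; case: z => q r; have [Hi _ _ _] := quat_conjP (oct_base A).
rewrite /omul /= Hi raddfN !mulNr scalerN mulrN scalerN quat_conjC.
by rewrite subrr addNr.
Qed.

Lemma omulZr k z w : z *o (k *: w) = k *: (z *o w).
Proof.
case: z w => q r [s t]; congr pair.
  by rewrite /= linearZ -scalerAr -scalerAl scalerDr !scalerA mulrC.
by rewrite /= linearZ -scalerAr -scalerAl scalerDr.
Qed.

Lemma omulZl k z w : (k *: z) *o w = k *: (z *o w).
Proof.
case: z w => q r [s t]; congr pair.
  by rewrite /= -scalerAr -scalerAl scalerDr !scalerA mulrC.
by rewrite /= -scalerAr -scalerAl scalerDr.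
Qed.

Lemma omulV z : onorm z != 0 -> z *o oinv z = oone.
Proof. by move=> nz; rewrite omulZr -onormE scalerA mulVf ?scale1r. Qed.

Lemma omulVo z : onorm z != 0 -> oinv z *o z = oone.
Proof. by move=> nz; rewrite omulZl onormC scalerA mulVf ?scale1r. Qed.

End Octonion.

Arguments oone {F} A.
Notation "x *o y" := (omul x y) (at level 40, left associativity).

(* Main.v *)
From HB Require Import structures.
Require Import Defs.
From mathcomp Require Import all_boot all_algebra all_field.
From mathcomp Require Import classical_sets.

(* For mu of the trace and norm of lam, the polynomial c f takes the value    *)
(* (c E) mu + c G. So if E = 0, then G = 0 and f vanishes on all of [lam].    *)
(* If E != 0, the only possible root in [lam] is mu = - (c E)^-1 (c G). By    *)
(* multiplicativity of the norm it has the trace and norm of lam = - E^-1 G   *)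
(* for every c, hence lies in [lam]; writing c = a + b l in the doubling of U *)
(* and expanding gives the formula.                                           *)

Set Implicit Arguments.
Unset Strict Implicit.
Unset Printing Implicit Defensive.
Import GRing.Theory.
Local Open Scope ring_scope.

(** On elements of trace [T] and norm [N] every power is a combination of z and 1, so a root of c f
    among them solves the linear equation (c E) z + c G = 0 ([oeval_oscale]). The product is not
    associative, so c does not cancel and the solution moves with c. It keeps the trace and norm of
    [lam] ([trnorm_omul_root]) because multiplication by c scales the norm and its polar form by
    [onorm c] ([onormM], [obilMl]), and equal trace and norm mean conjugate ([trnorm_conj]).

    These identities come from [omulKl], its mirror image [omulKr] and their polarizations, which
    replace associativity. The same polarizations show that a nonzero l orthogonal to a quaternion
    subalgebra doubles it to A ([cayley_doubling_orth]). In any such doubling, [doubling_inv_omul]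
    computes (c E)^-1 (c G) for c = a + b l. *)

Section OctonionTheory.
Variables (F : fieldType) (A : octonionAlgebra F).
Implicit Types (x y z w : A) (k : F).

(** * Linearity of the octonion product and its conjugation *)

Lemma quat_norm_central (q r : oct_base A) :
  q * quat_conj q * r = r * (q * quat_conj q).
Proof.
have [_ _ _ /(_ q)/vlineP[k ->]] := quat_conjP (oct_base A).
by rewrite -scalerAl -scalerAr mul1r mulr1.
Qed.

Lemma omul_linear z : linear (omul z).
Proof.
case: z => q r k [s t] [u v]; congr pair; rewrite /=.
  rewrite linearP mulrDr mulrDl !scalerDr -!scalerAr -!scalerAl !scalerA.
  by rewrite (mulrC k) addrACA.
by rewrite linearP mulrDl mulrDr scalerDr -scalerAl -scalerAr addrACA.
Qed.
HB.instance Definition _ z :=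
  GRing.isLinear.Build F A A *:%R (omul z) (omul_linear z).

(** The fixed right factor comes first so that right multiplication can carry a linear structure. *)
Definition omulr z w := w *o z.

Lemma omulr_linear z : linear (omulr z).
Proof.
case: z => q r k [s t] [u v]; congr pair; rewrite /=.
  rewrite mulrDr mulrDl !scalerDr -!scalerAr -!scalerAl !scalerA.
  by rewrite (mulrC k) addrACA.
by rewrite mulrDl mulrDr scalerDr -scalerAl -scalerAr addrACA.
Qed.
HB.instance Definition _ z :=
  GRing.isLinear.Build F A A *:%R (omulr z) (omulr_linear z).

Lemma oconj_linear : linear (@oconj F A).
Proof.
by move=> k [s t] [u v]; congr pair; rewrite /= ?linearP // opprD scalerN.
Qed.
HB.instance Definition _ :=
  GRing.isLinear.Build F A A *:%R (@oconj F A) oconj_linear.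

Lemma omulDr z x y : z *o (x + y) = z *o x + z *o y. Proof. exact: linearD. Qed.
Lemma omulNr z x : z *o (- x) = - (z *o x). Proof. exact: linearN. Qed.
Lemma omulBr z x y : z *o (x - y) = z *o x - z *o y. Proof. exact: linearB. Qed.
Lemma omul0r z : z *o 0 = 0. Proof. exact: linear0. Qed.
Lemma omulDl z x y : (x + y) *o z = x *o z + y *o z.
Proof. exact: (linearD (omulr z)). Qed.
Lemma omulNl z x : (- x) *o z = - (x *o z).
Proof. exact: (linearN (omulr z)). Qed.
Lemma omulBl z x y : (x - y) *o z = x *o z - y *o z.
Proof. exact: (linearB (omulr z)). Qed.
Lemma omul0l z : 0 *o z = 0. Proof. exact: (linear0 (omulr z)). Qed.

Lemma oconjD x y : oconj (x + y) = oconj x + oconj y.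
Proof. exact: linearD. Qed.
Lemma oconjZ k x : oconj (k *: x) = k *: oconj x. Proof. exact: linearZ. Qed.

Lemma omul1l z : oone A *o z = z.
Proof.
case: z => q r.
by rewrite /omul /= mulr0 scaler0 addr0 mul1r mulr1 mul0r addr0.
Qed.

Lemma quat_conj1 : quat_conj 1 = 1 :> oct_base A.
Proof.
have [Hi Hm _ _] := quat_conjP (oct_base A).
by have := Hm (quat_conj 1) 1; rewrite mulr1 Hi mulr1.
Qed.

Lemma omul1r z : z *o oone A = z.
Proof.
case: z => q r.
by rewrite /omul /= quat_conj1 linear0 !mul0r scaler0 addr0 !mulr1 add0r.
Qed.

Lemma oconjK : involutive (@oconj F A).
Proof.
case=> q r; have [Hi _ _ _] := quat_conjP (oct_base A).
by rewrite /oconj /= Hi opprK.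
Qed.

Lemma oconj1 : oconj (oone A) = oone A.
Proof. by rewrite /oconj /= quat_conj1 oppr0. Qed.

Lemma oconjM x y : oconj (x *o y) = oconj y *o oconj x.
Proof.
case: x y => q r [s t]; have [Hi Hm _ _] := quat_conjP (oct_base A).
rewrite /oconj /omul /=; congr pair.
  by rewrite linearD linearZ /= !Hm !Hi linearN mulNr mulrN opprK.
by rewrite Hi !mulNr opprD addrC.
Qed.

Lemma oconjE z : oconj z = otr z *: oone A - z.
Proof. by rewrite otrE addrC addKr. Qed.

(** * The norm and its polar form *)

Lemma scale1_inj : injective (fun k => k *: oone A).
Proof.
move=> k k' [] /eqP; rewrite -subr_eq0 -scalerBl scaler_eq0 oner_eq0 orbF.
by rewrite subr_eq0 => /eqP.
Qed.

(** In coordinates this only uses that the quaternion algebra is associative and that quaternion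
    norms are central. *)
Lemma omulKl x y : oconj x *o (x *o y) = onorm x *: y.
Proof.
case: x y => q r [s t]; have [Hi Hm _ _] := quat_conjP (oct_base A).
have Hn : (onorm ((q, r) : A))%:A =
    q * quat_conj q - oct_gamma A *: (r * quat_conj r).
  have [] := onormE ((q, r) : A); rewrite /= linearN mulNr scalerN => -> _.
  by rewrite quat_conjC.
congr pair => /=; rewrite -[RHS]mulr_algl Hn mulrBl -scalerAl quat_norm_central.
  have -> : s * (q * quat_conj q) = quat_conj q * (q * s).
    by rewrite -quat_norm_central -quat_conjC mulrA.
  rewrite quat_norm_central -quat_conjC linearD /= !Hm Hi mulrDr -scalerAr mulrN.
  by rewrite mulrDl scalerN scalerDr !mulrA opprD addrA addrK.
rewrite mulNr linearD linearZ /= !Hm Hi mulrDl mulrDr -scalerAr.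
by rewrite !mulrA opprD addrA addrK.
Qed.

Lemma onorm_conj x : onorm (oconj x) = onorm x.
Proof. by apply: scale1_inj; rewrite onormE oconjK onormC. Qed.

Lemma omulKr x y : (y *o x) *o oconj x = onorm x *: y.
Proof.
apply: (can_inj oconjK); rewrite linearZ /= -(onorm_conj x) -omulKl.
by rewrite !oconjM !oconjK.
Qed.

(* The polar form of onorm. *)
Definition obil x y : F := otr (x *o oconj y).

Lemma obilE x y : obil x y *: oone A = x *o oconj y + y *o oconj x.
Proof. by rewrite otrE oconjM oconjK. Qed.

Lemma obilC x y : obil x y = obil y x.
Proof. by apply: scale1_inj; rewrite !obilE addrC. Qed.

Lemma obilP y k x z : obil y (k *: x + z) = k * obil y x + obil y z.
Proof.
apply: scale1_inj; rewrite scalerDl -scalerA !obilE.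
by rewrite linearP [_ *o oconj y]omulDl omulDr omulZl omulZr scalerDr addrACA.
Qed.
HB.instance Definition _ y :=
  GRing.isLinear.Build F A F *%R (obil y) (obilP y).

Lemma obil1 x : obil x (oone A) = otr x.
Proof. by rewrite /obil oconj1 omul1r. Qed.

Lemma onormD x y : onorm (x + y) = onorm x + onorm y + obil x y.
Proof.
apply: scale1_inj; rewrite !scalerDl obilE !onormE.
by rewrite oconjD omulDl !omulDr [y *o _ + _]addrC addrACA.
Qed.

Lemma onorm1 : onorm (oone A) = 1.
Proof. by apply: scale1_inj; rewrite onormE oconj1 omul1r scale1r. Qed.

Lemma onorm0 : onorm (0 : A) = 0.
Proof. by apply: scale1_inj; rewrite onormE omul0l scale0r. Qed.

Lemma onormZ k x : onorm (k *: x) = k ^+ 2 * onorm x.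
Proof.
by apply: scale1_inj; rewrite onormE oconjZ omulZl omulZr -onormE !scalerA.
Qed.

Lemma onormN x : onorm (- x) = onorm x.
Proof. by rewrite -scaleN1r onormZ sqrrN expr1n mul1r. Qed.

Lemma omulKl_polar x y z :
  oconj x *o (y *o z) + oconj y *o (x *o z) = obil x y *: z.
Proof.
have := omulKl (x + y) z; rewrite onormD oconjD omulDl [(x + y) *o z]omulDl.
rewrite !omulDr !omulKl !scalerDl => H; apply: addrI (etrans _ H).
by rewrite addrACA [onorm y *: z + _]addrC.
Qed.

Lemma omulKr_polar x y z :
  (z *o x) *o oconj y + (z *o y) *o oconj x = obil x y *: z.
Proof.
have := omulKr (x + y) z; rewrite onormD oconjD omulDr.
rewrite !(omulDl, omulDr) !omulKr !scalerDl => H; apply: addrI (etrans _ H).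
by rewrite [_ *o _ + _ *o oconj x]addrC addrACA [onorm y *: z + _]addrC.
Qed.

Lemma omulKl' x y : x *o (oconj x *o y) = onorm x *: y.
Proof. by rewrite -{1}[x]oconjK omulKl onorm_conj. Qed.

Lemma otr_conj x : otr (oconj x) = otr x.
Proof. by rewrite /otr oconjK addrC. Qed.

Lemma osqrE x : x *o x = otr x *: x - onorm x *: oone A.
Proof.
by rewrite onormE oconjE omulBr omulZr omul1r opprB addrC subrK.
Qed.

(** The left and right polarized identities, taken at [oconj x] and y and applied to x, have the
    same right-hand side and share the term [onorm x *: oconj y]. *)
Lemma omul_flexible x y : x *o (y *o x) = (x *o y) *o x.
Proof.
have := omulKl_polar (oconj x) y x; have := omulKr_polar y (oconj x) x.
rewrite oconjK -onormE omulZl onormC omulZr omul1l omul1r obilC => <-.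
exact: addIr.
Qed.

Lemma obilMr x y : obil (y *o x) y = onorm y * otr x.
Proof.
apply: scale1_inj; rewrite obilE oconjM (oconjE x) omulBl omulBr.
rewrite omulZl omul1l omulZr -onormE (oconjE y) !omulBr !omulZr !omul1r.
by rewrite omul_flexible addrC subrK scalerA mulrC.
Qed.

(** The left polarized identity at conj(xy) and conj y, applied to conj x, has onorm(xy) as its
    first term. Writing one conj x as tr x - x in the second term, the parts with tr x cancel
    against the right-hand side by [obilMr]. *)
Lemma onormM x y : onorm (x *o y) = onorm x * onorm y.
Proof.
apply: scale1_inj.
have := omulKl_polar (oconj y *o oconj x) (oconj y) (oconj x).
rewrite obilMr onorm_conj otr_conj -{1 2}oconjM oconjK.
rewrite -onormE {2}(oconjE x) omulBr omulZr omul1r.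
have := omulKr (oconj x) (oconj y); rewrite onorm_conj !oconjK => ->.
rewrite omulBr !omulZr omulKl' -onormE !scalerA mulrC addrCA addrC => /eqP.
by rewrite -subr_eq0 addrK subr_eq0 => /eqP.
Qed.

Lemma obilMl z x y : obil (z *o x) (z *o y) = onorm z * obil x y.
Proof.
have := onormM z (x + y); rewrite omulDr !onormD !onormM !mulrDr.
exact: addrI.
Qed.

Lemma onorm_unit z : ounit z -> onorm z != 0.
Proof.
case=> w [zw _]; apply/eqP => z0; have := onormM z w.
by rewrite zw onorm1 z0 mul0r => /eqP; rewrite oner_eq0.
Qed.

Lemma omulVKl z x : onorm z != 0 -> oinv z *o (z *o x) = x.
Proof. by move=> nz; rewrite omulZl omulKl scalerA mulVf ?scale1r. Qed.

Lemma omulKVl z x : onorm z != 0 -> z *o (oinv z *o x) = x.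
Proof. by move=> nz; rewrite omulZl omulZr omulKl' scalerA mulVf ?scale1r. Qed.

Lemma omulKVr z x : onorm z != 0 -> (x *o z) *o oinv z = x.
Proof. by move=> nz; rewrite omulZr omulKr scalerA mulVf ?scale1r. Qed.

(** * Orthogonal vectors and conjugacy *)

Lemma dim_oct : \dim {:A} = 8%N.
Proof.
have [dB _ _] := quat_algP (oct_base A).
by rewrite dimvf -[8%N]/(4 + 4)%N -dB dimvf.
Qed.

Lemma exists_orthogonal (U : {vspace A}) : (\dim U < 8)%N ->
  exists2 z : A, z != 0 & {in U, forall u, obil u z = 0}.
Proof.
move=> dU; pose e := vbasis U.
(* [phi] takes values in [U], so it has a nonzero kernel by rank-nullity; freeness of the basis
   makes that kernel orthogonal to [U]. *)
pose phi (z : A) : A := \sum_(i < \dim U) obil e`_i z *: e`_i.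
have phi_lin : linear phi.
  move=> k x y; rewrite /phi scaler_sumr -big_split /=; apply: eq_bigr => i _.
  by rewrite obilP scalerDl scalerA.
pose phiL := GRing.isLinear.Build F A A *:%R phi phi_lin.
pose Phi : {linear A -> A} := HB.pack phi phiL.
pose K := lker (linfun Phi).
have nz : vpick K != 0.
  rewrite vpick0 -dimv_eq0 -lt0n -(ltn_add2r (\dim (linfun Phi @: fullv))).
  rewrite -(capfv K) limg_ker_dim dim_oct (leq_ltn_trans _ dU) //.
  apply/dimvS/subvP => w /memv_imgP[z _ ->]; rewrite lfunE /= /phi.
  apply: memv_suml => i _; apply/memvZ/vbasis_mem/mem_nth.
  by rewrite size_tuple.
exists (vpick K) => // u Uu.
have := memv_pick K; rewrite memv_ker lfunE /= => /eqP phi0.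
have := basis_free (vbasisP U) => /freeP/(_ _ phi0) e0.
rewrite (coord_vbasis Uu) obilC linear_sum big1 // => i _.
by rewrite linearZ /= obilC e0 mulr0.
Qed.

Lemma otrZ k z : otr (k *: z) = k * otr z.
Proof. by rewrite -!obil1 -!(obilC (oone A)) linearZ. Qed.

Lemma conj_trnorm z w : onorm z != 0 ->
  otr ((z *o w) *o oinv z) = otr w /\ onorm ((z *o w) *o oinv z) = onorm w.
Proof.
move=> nz; split.
  rewrite omulZr otrZ -/(obil (z *o w) z) obilMr mulrA.
  by rewrite mulVf ?mul1r.
rewrite omulZr onormZ !onormM onorm_conj [_ z * _ * _]mulrAC -expr2 mulrA.
by rewrite -exprMn mulVf // expr1n mul1r.
Qed.

(* The conjugator is q = z - conj w if this is nonzero; otherwise z = conj w  *)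
(* and any q orthogonal to 1 and conj w will do.                              *)
Lemma trnorm_conj z w : odivision A -> otr z = otr w -> onorm z = onorm w ->
  conjclass w z.
Proof.
move=> D tE nE.
suff [q q0 qE] : exists2 q : A, q != 0 & q *o w = z *o q.
  exists q => [|/=]; first exact: D.
  by rewrite qE omulKVr ?onorm_unit //; apply: D.
have [zE|zN] := eqVneq z (oconj w); last first.
  exists (z - oconj w); first by rewrite subr_eq0.
  rewrite omulBl omulBr osqrE onormC nE tE oconjE omulBr omulZr omul1r.
  by rewrite opprB [RHS]addrC addrA subrK.
have dU : (\dim <<[:: oone A; oconj w]>> < 8)%N.
  exact: leq_ltn_trans (dim_span _) _.
have [q q0 qU] := exists_orthogonal dU; exists q => //.
have := qU (oone A); have := qU (oconj w).
rewrite !memv_span ?inE ?eqxx ?orbT // => /(_ isT) qw /(_ isT) q1.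
have := obilE q (oconj w); rewrite obilC qw scale0r oconjK zE.
rewrite [oconj q]oconjE -obil1 obilC q1 scale0r sub0r omulNr => /eqP.
by rewrite eq_sym subr_eq0 => /eqP.
Qed.

(** * Values of polynomials at elements of given trace and norm *)

Lemma opowE z n :
  opow z n = (pq (onorm z) (otr z) n).1 *: z + (pq (onorm z) (otr z) n).2 *: oone A.
Proof.
elim: n => [|n IHn] /=; first by rewrite scale0r scale1r add0r.
case: (pq _ _ n) IHn => p q /= ->.
rewrite omulDr !omulZr omul1r osqrE scalerBr !scalerA addrAC -scalerDl.
by rewrite scaleNr [_ * p]mulrC [onorm _ * p]mulrC.
Qed.

Lemma oeval_oscale n (f : 'I_n.+1 -> A) c z :
  oeval (oscale c f) z =
  (c *o Epol f (onorm z) (otr z)) *o z + c *o Gpol f (onorm z) (otr z).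
Proof.
rewrite /Epol /Gpol !linear_sum /= -/(omulr z _) linear_sum -big_split /=.
apply: eq_bigr => k _; rewrite opowE omulDr /omulr !omulZr omul1r.
by rewrite omulZl.
Qed.

Lemma oevalE n (f : 'I_n.+1 -> A) z :
  oeval f z = Epol f (onorm z) (otr z) *o z + Gpol f (onorm z) (otr z).
Proof.
rewrite -[Epol _ _ _]omul1l -[Gpol _ _ _]omul1l -oeval_oscale.
by apply: eq_bigr => k _; rewrite /oscale omul1l.
Qed.

(** For the trace, n(cE) tr w is the polar form of (cE)w = -cG and cE, which is n(c) times that of
    -G = Ez and E, hence n(cE) tr z. The norm is compared in the same way. *)
Lemma trnorm_omul_root c E G z w : onorm c != 0 -> onorm E != 0 ->
  E *o z + G = 0 -> (c *o E) *o w + c *o G = 0 ->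
  otr w = otr z /\ onorm w = onorm z.
Proof.
move=> c0 E0 /eqP; rewrite addr_eq0 => /eqP zE.
move=> /eqP; rewrite addr_eq0 => /eqP wE.
have cE0 : onorm (c *o E) != 0 by rewrite onormM mulf_neq0.
split; apply: (mulfI cE0).
  by rewrite -obilMr wE onormM -mulrA -obilMr zE -omulNr obilMl.
by rewrite -onormM wE onormM -mulrA -onormM zE !onormN onormM.
Qed.

(** * Quaternion subalgebras and Cayley doublings *)

Section Division.
Hypothesis divA : odivision A.

Lemma onorm_neq0 z : (onorm z != 0) = (z != 0).
Proof.
apply/idP/idP => [|/divA/onorm_unit //].
by apply: contraNneq => ->; rewrite onorm0.
Qed.

Section Subalgebra.
Variable U : {vspace A}.
Hypothesis algU : quaternion_subalgebra U.
Implicit Types q r s t u : A.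

Lemma dim_quatsub : \dim U = 4%N.
Proof.
have [B [i [[dB _ _] keri _ _ <-]]] := algU.
by rewrite limg_dim_eq ?dB // keri capv0.
Qed.

Lemma quatsub1 : oone A \in U.
Proof. by have [B [i [_ _ <- _ <-]]] := algU; rewrite memv_img ?memvf. Qed.

Lemma quatsubM q r : q \in U -> r \in U -> q *o r \in U.
Proof.
have [B [i [_ _ _ iM <-]]] := algU.
by move=> /memv_imgP[x _ ->] /memv_imgP[y _ ->]; rewrite -iM memv_img ?memvf.
Qed.

Lemma quatsubA q r s : q \in U -> r \in U -> s \in U ->
  q *o (r *o s) = (q *o r) *o s.
Proof.
have [B [i [_ _ _ iM <-]]] := algU.
move=> /memv_imgP[x _ ->] /memv_imgP[y _ ->] /memv_imgP[z _ ->].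
by rewrite -!iM mulrA.
Qed.

Lemma quatsub_noncomm : ~ {in U &, forall q r, q *o r = r *o q}.
Proof.
have [B [i [[dB ZB _] /eqP/lker0P iI _ iM <-]]] := algU => UC.
suff : (fullv <= 'Z({:B}))%VS by rewrite ZB => /dimvS; rewrite dB dimv1.
rewrite subv_cap subvv; apply/centvsP => x y _ _; apply: iI.
by rewrite !iM UC ?memv_img ?memvf.
Qed.

Lemma quatsub_conj q : q \in U -> oconj q \in U.
Proof. by move=> Uq; rewrite oconjE memvB ?memvZ ?quatsub1. Qed.

Lemma quatsub_inv q : q \in U -> oinv q \in U.
Proof. by move=> Uq; rewrite memvZ ?quatsub_conj. Qed.

(* If q is nonzero and orthogonal to U, the trace vanishes on U, so oconj is  *)
(* the opposite there and U is commutative: this also covers char. 2.         *)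
Lemma quatsub_nondeg q : q \in U -> {in U, forall u, obil u q = 0} -> q = 0.
Proof.
move=> Uq qU; have [// | ] := eqVneq q 0; rewrite -onorm_neq0 => q0.
case: quatsub_noncomm.
have tr0 u : u \in U -> oconj u = - u.
  move=> Uu; rewrite oconjE; suff -> : otr u = 0 by rewrite scale0r sub0r.
  by apply: (mulfI q0); rewrite -obilMr qU ?mulr0 ?quatsubM.
have N u : u \in U -> - u = u.
  move=> Uu; have := tr0 _ quatsub1; rewrite oconj1 => one.
  by rewrite -[u in RHS]omul1l one omulNl omul1l.
move=> u v Uu Uv; have Uuv := quatsubM Uu Uv.
by rewrite -(N _ Uuv) -tr0 // oconjM !tr0 // omulNl omulNr opprK.
Qed.

Section Orthogonal.
Variable l : A.
Hypotheses (l0 : l != 0) (Ul : {in U, forall u, obil u l = 0}).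

Lemma oconj_orth : oconj l = - l.
Proof. by rewrite oconjE -obil1 obilC Ul ?quatsub1 // scale0r sub0r. Qed.

Lemma oconj_omul_orth u : u \in U -> oconj (u *o l) = - (u *o l).
Proof.
move=> Uu; rewrite oconjE; suff -> : otr (u *o l) = 0 by rewrite scale0r sub0r.
by rewrite -[l]oconjK -/(obil u _) oconj_orth linearN /= Ul // oppr0.
Qed.

Lemma orth_omulC u : u \in U -> l *o oconj u = u *o l.
Proof.
move=> Uu; apply: oppr_inj; rewrite -oconj_omul_orth // oconjM oconj_orth.
by rewrite omulNl.
Qed.

(** Writing u = v (v^-1 u), the factor v comes out as its norm, leaving an element of [U] paired
    with [l]. *)
Lemma obil_omul_orth u v : u \in U -> v \in U -> obil u (v *o l) = 0.
Proof.
move=> Uu Uv; have [-> | ] := eqVneq v 0; first by rewrite omul0l linear0.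
rewrite -onorm_neq0 => v0.
by rewrite -[u](omulKVl _ v0) obilMl Ul ?mulr0 ?quatsubM ?quatsub_inv.
Qed.

(** Each of the three mixed products is a polarized identity whose right-hand side vanishes by
    orthogonality. *)
Lemma doubling_mul q r s t : q \in U -> r \in U -> s \in U -> t \in U ->
  (q + r *o l) *o (s + t *o l) =
  (q *o s + (- onorm l) *: (oconj t *o r)) + (t *o q + r *o oconj s) *o l.
Proof.
move=> Uq Ur Us Ut.
have qtl : q *o (t *o l) = (t *o q) *o l.
  have := omulKl_polar (oconj q) l (oconj t).
  rewrite Ul ?quatsub_conj // scale0r oconjK oconj_orth orth_omulC // omulNl.
  by move/eqP; rewrite subr_eq0 => /eqP ->; rewrite -oconjM orth_omulC ?quatsubM.
have rls : (r *o l) *o s = (r *o oconj s) *o l.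
  have := omulKr_polar l (oconj s) r.
  rewrite obilC Ul ?quatsub_conj // scale0r oconjK oconj_orth // omulNr.
  by move/eqP; rewrite subr_eq0 => /eqP.
have rltl : (r *o l) *o (t *o l) = - onorm l *: (oconj t *o r).
  have := omulKl_polar (r *o l) t l.
  rewrite obilC obil_omul_orth // scale0r oconj_omul_orth // omulNl.
  rewrite addrC => /eqP; rewrite subr_eq0 => /eqP <-.
  by rewrite -{2}[l]opprK -oconj_orth omulNr omulKr -scaleNr omulZr.
by rewrite omulDl !omulDr qtl rls rltl [_ *o l + _ *: _]addrC addrACA -omulDl.
Qed.

Lemma cayley_doubling_orth : cayley_doubling U l (- onorm l).
Proof.
split=> [||z|q r Uq Ur s t Us Ut|q r Uq Ur].
- by rewrite oppr_eq0 onorm_neq0.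
- by rewrite scaleNr onormE oconj_orth omulNr opprK.
- have inj_l : injective (fun z : A => z *o l).
    by move=> x y /(congr1 (fun w => w *o oinv l)); rewrite !omulKVr // onorm_neq0.
  (* An element of [U] that lies in U l is orthogonal to [U], hence zero; so the sum is direct and
     has dimension 4 + 4 = 8. *)
  have disj p q : p \in U -> q \in U -> p = q *o l -> p = 0.
    move=> Up Uq pE; apply: quatsub_nondeg => // u Uu.
    by rewrite pE obil_omul_orth.
  pose L := linfun (omulr l).
  have LE (x : A) : L x = x *o l by rewrite lfunE.
  have sumE : (U + L @: U)%VS = fullv.
    apply/eqP; rewrite eqEdim subvf dim_oct dimv_disjoint_sum.
      rewrite limg_dim_eq ?dim_quatsub //.
      suff /eqP -> : lker L == 0%VS by rewrite capv0.
      by apply/lker0P => x y; rewrite !LE; apply: inj_l.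
    apply/eqP; rewrite -subv0; apply/subvP => x.
    rewrite memv_cap => /andP[Ux /memv_imgP[y Uy xE]].
    by rewrite (disj x y) ?mem0v // -LE.
  have := memvf z; rewrite -sumE => /memv_addP[p Up [_ /memv_imgP[q Uq ->] zE]].
  rewrite LE in zE; exists (p, q); split=> // -[p' q'] /= [Up' Uq' zE'].
  have E : p - p' = (q' - q) *o l.
    apply/eqP; rewrite omulBl subr_eq addrAC eq_sym subr_eq -zE zE'.
    by rewrite addrC.
  have p0 := disj _ _ (memvB Up Up') (memvB Uq' Uq) E.
  move: E; rewrite p0 -(omul0l l) => /inj_l/esym/eqP.
  by move: p0 => /eqP; rewrite !subr_eq0 => /eqP -> /eqP ->.
- exact: doubling_mul.
- by rewrite oconjD oconj_omul_orth.
Qed.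
End Orthogonal.

Lemma exists_cayley_doubling : exists l g, cayley_doubling U l g.
Proof.
have [|l l0 Ul] := @exists_orthogonal U; first by rewrite dim_quatsub.
by exists l, (- onorm l); apply: cayley_doubling_orth.
Qed.

(** * The root of a linear equation in doubling coordinates *)

Section Doubling.
Variables (l : A) (g : F) (a b E G : A).
Hypotheses (UD : cayley_doubling U l g).
Hypotheses (Ua : a \in U) (Ub : b \in U) (UE : E \in U) (UG : G \in U).
Local Notation c := (a + b *o l).

Lemma doubling_omulE u : u \in U -> c *o u = a *o u + (b *o oconj u) *o l.
Proof.
have [_ _ _ Umul _] := UD; move=> Uu.
have := Umul _ _ Ua Ub _ _ Uu (mem0v U).
by rewrite linear0 !omul0l scaler0 !addr0 add0r.
Qed.

(** Both factors expand by the doubling product, after which everything lies in the associative [U]: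
    the norms of a and b come out as scalars, and the two terms in l differ by the order of conj E
    and conj G. *)
Lemma doubling_conj_omul :
  oconj (c *o E) *o (c *o G) =
  onorm a *: (oconj E *o G) - (g * onorm b) *: (G *o oconj E)
    + ((b *o ocomm (oconj G) (oconj E)) *o oconj a) *o l.
Proof.
have [_ _ _ Umul Uconj] := UD; rewrite !doubling_omulE //.
have UaE := quatsubM Ua UE; have UaG := quatsubM Ua UG.
have UbE := quatsubM Ub (quatsub_conj UE).
have UbG := quatsubM Ub (quatsub_conj UG).
rewrite Uconj // -omulNl Umul ?memvN ?quatsub_conj //; congr (_ + _ *o l).
  rewrite omulNr scalerN -scalerA !oconjM oconjK.
  rewrite -(quatsubA (quatsub_conj UE)) ?quatsub_conj // omulKl omulZr.
  by rewrite -(quatsubA UG) ?quatsub_conj // omulKl omulZr.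
rewrite !oconjM omulNl omulBr omulBl.
by rewrite !quatsubA ?quatsubM ?quatsub_conj.
Qed.

Lemma doubling_inv_omul : E != 0 ->
  oinv (c *o E) *o (c *o G) =
  (onorm c)^-1 *: (onorm a *: (oinv E *o G) - (g * onorm b) *: (G *o oinv E)
    + ((b *o ocomm (oconj G) (oinv E)) *o oconj a) *o l).
Proof.
rewrite -onorm_neq0 => E0; rewrite omulZl doubling_conj_omul onormM invfM.
(* Each term contains conj E exactly once, so a factor [onorm E] comes out and cancels the one in
   onorm(cE). *)
have -> : oconj E = onorm E *: oinv E by rewrite scalerA mulfV ?scale1r.
rewrite /ocomm !(omulZl, omulZr) -scalerBr !(omulZl, omulZr).
rewrite ![_ *: (onorm E *: _)]scalerA ![_ * onorm E]mulrC -!scalerA.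
by rewrite -scalerBr -scalerDr [_^-1 *: (onorm E *: _)]scalerA mulVf ?scale1r.
Qed.
End Doubling.
End Subalgebra.
End Division.
End OctonionTheory.

Theorem theorem3p4 (F : fieldType) (A : octonionAlgebra F)
    (n : nat) (f : 'I_n.+1 -> A) (lam : A) :
  odivision A ->
  oroots f lam ->
  let T := otr lam in
  let N := onorm lam in
  let E := Epol f N T in
  let G := Gpol f N T in
  (E = 0 -> subset (conjclass lam) (LMR f))
  /\
  (E != 0 ->
   forall U : {vspace A}, quaternion_subalgebra U -> E \in U -> G \in U ->
     (exists (l : A) (g : F), cayley_doubling U l g)
     /\
     (forall (l : A) (g : F), cayley_doubling U l g ->
        setI (LMR f) (conjclass lam) =
        [set mu : A | exists a b : A,
           [/\ a \in U, b \in U, (a, b) != (0, 0)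
             & mu = (- (onorm (a + b *o l))^-1) *:
                 (onorm a *: (oinv E *o G) - (g * onorm b) *: (G *o oinv E)
                  + ((b *o ocomm (oconj G) (oinv E)) *o oconj a) *o l)]]%classic)).
Proof.
move=> divA lam_root T N E G.
have EG : E *o lam + G = 0 by rewrite -oevalE.
have tn mu : conjclass lam mu -> otr mu = T /\ onorm mu = N.
  by case=> q /onorm_unit q0 <-; apply: conj_trnorm.
split=> [E0 mu /tn[tmu nmu] | E0 U algU UE UG].
  have G0 : G = 0 by rewrite -EG E0 omul0l add0r.
  (* With E = G = 0, every c makes c f vanish on the class; c = 1 is taken. *)
  exists (oone A); first by exists (oone A); rewrite omul1l.
  by rewrite /oroots /= oeval_oscale tmu nmu -/E -/G E0 G0 !omul0r omul0l addr0.
split=> [|l g UD]; first exact: exists_cayley_doubling.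
have Eunit : onorm E != 0 by rewrite onorm_neq0.
apply/seteqP; split=> mu.
  case=> -[c cu cmu] /tn[tmu nmu].
  move: cmu; rewrite /oroots /= oeval_oscale tmu nmu -/E -/G => cmu.
  have c0 := onorm_unit cu.
  (* The parameters a and b are the coordinates of the multiplier c in the doubling. *)
  have [_ _ /(_ c)[[a b] [[/= Ua Ub cE] _]] _ _] := UD.
  exists a, b; split=> //.
    by apply: contraNneq c0 => -[a0 b0]; rewrite cE a0 b0 omul0l addr0 onorm0.
  rewrite scaleNr -(doubling_inv_omul divA algU UD) // -cE.
  move/eqP: cmu; rewrite addr_eq0 => /eqP/(congr1 (omul (oinv (c *o E)))).
  by rewrite omulVKl ?onormM ?mulf_neq0 // omulNr.
case=> a [b [Ua Ub ab0 muE]].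
pose c := a + b *o l.
(* Uniqueness of the coordinates of 0 turns (a, b) != (0, 0) into c != 0. *)
have c0 : c != 0.
  apply: contra ab0 => /eqP c0.
  have [_ _ /(_ 0)[p [_ p_uniq]] _ _] := UD.
  have <- : p = (a, b) by apply: p_uniq.
  by apply/eqP/p_uniq; split; rewrite ?mem0v // [(0, 0).2]/(0 : A) omul0l addr0.
have cn : onorm c != 0 by rewrite onorm_neq0.
have cmu : (c *o E) *o mu + c *o G = 0.
  rewrite muE scaleNr -(doubling_inv_omul divA algU UD) // omulNr omulKVl ?addNr //.
  by rewrite onormM mulf_neq0.
(* [E] and [G] were formed with the trace and norm of [lam]; only now that [mu] shares them does the
   linear equation say that [mu] is a root of c f. *)
have [tmu nmu] := trnorm_omul_root cn Eunit EG cmu.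
split; last exact: trnorm_conj.
by exists c; [exact: divA | rewrite /oroots /= oeval_oscale tmu nmu].
Qed.
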